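(* Fix a round $t$ and a state $s_t$, and suppose $F_t(\cdot;s_t)$ is normalized, monotone, submodular and has bounded marginals (as in the context). Let $D=\max_{\mathbf{x},\mathbf{y}\in\mathcal{F}_t}\|\mathbf{x}-\mathbf{y}\|_2$, let $K\ge 1$, and let $G,\sigma\ge 0$ with $G^2+\sigma^2>0$. Let $\mathbf{x}_0\in\mathcal{F}_t$ and consider the projected stochastic gradient ascent iterates $$\mathbf{x}_{k+1}=\Pi_{\mathcal{F}_t}(\mathbf{x}_k+\eta\,\mathbf{g}_k),\qquad k=0,\dots,K-1,\qquad \eta=\frac{D}{\sqrt{K(G^2+\sigma^2)}},$$ where $\Pi_{\mathcal{F}_t}$ is Euclidean projection onto $\mathcal{F}_t$ and the random vectors $\mathbf{g}_k$ satisfy: $\|\nabla\tilde f_t(\mathbf{x};s_t)\|_2\le G$ for all $\mathbf{x}\in\mathcal{F}_t$; $\mathbb{E}[\mathbf{g}_k\mid\mathbf{x}_k]=\nabla\tilde f_t(\mathbf{x}_k;s_t)$; and $\mathbb{E}[\|\mathbf{g}_k-\nabla\tilde f_t(\mathbf{x}_k;s_t)\|_2^2\mid\mathbf{x}_k]\le\sigma^2$. Then $$\frac1K\sum_{k=0}^{K-1}\mathbb{E}\big[\tilde f_t(\mathbf{x}_k;s_t)\big]\;\ge\;\frac12\,\mathrm{OPT}_t(s_t)-\frac{D\sqrt{G^2+\sigma^2}}{2\sqrt K},\qquad \mathrm{OPT}_t(s_t)=\max_{A\in\mathcal{I}_t}F_t(A;s_t).$$ Consequently, if $k^*$ is sampled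 uniformly from $\{0,\dots,K-1\}$ (independently of the iterates) and $\pi_{k^*}$ is the factorized categorical policy with marginal vector $\mathbf{x}_{k^*}$ (each agent $i$ independently picks action $a$ with probability $(\mathbf{x}_{k^*})_{(i,a)}$), then $$\mathbb{E}\Big[\mathbb{E}_{A_t\sim\pi_{k^*}}[F_t(A_t;s_t)]\Big]\;\ge\;\frac12\,\mathrm{OPT}_t(s_t)-\frac{D(G+\sigma)}{2\sqrt K},$$ where the outer expectation is over $k^*$ and the stochastic gradient iterates.
   Context: $\mathcal{N}_t$ is a finite set of agents; each agent $i\in\mathcal{N}_t$ has a finite nonempty action set $\mathcal{A}_{i,t}$. Ground set $\Omega_t=\{(i,a): i\in\mathcal{N}_t, a\in\mathcal{A}_{i,t}\}$, with parts $\Omega_{i,t}=\{(i,a):a\in\mathcal{A}_{i,t}\}$; partition matroid $\mathcal{I}_t=\{A\subseteq\Omega_t: |A\cap\Omega_{i,t}|\le 1\ \forall i\}$. Polytope $\mathcal{P}(\mathcal{I}_t)=\{\mathbf{x}\in[0,1]^{\Omega_t}:\sum_{a\in\mathcal{A}_{i,t}}x_{(i,a)}\le 1\ \forall i\}$ and its face $\mathcal{F}_t=\{\mathbf{x}\in\mathcal{P}(\mathcal{I}_t):\sum_{a}x_{(i,a)}=1\ \forall i\}$. The utility $F_t(\cdot;s_t):2^{\Omega_t}\to\mathbb{R}_{\ge0}$, with marginal gain $F_t(e\mid A;s_t)=F_t(A\cup\{e\};s_t)-F_t(A;s_t)$. Assumptions: normalized, $F_t(\emptyset;s_t)=0$;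 monotone, $F_t(A;s_t)\le F_t(B';s_t)$ for $A\subseteq B'$; submodular, $F_t(e\mid A;s_t)\ge F_t(e\mid B';s_t)$ for $A\subseteq B'$, $e\notin B'$; bounded marginals, there is $B<\infty$ with $0\le F_t(e\mid A;s_t)\le B$ for all $A\in\mathcal{I}_t$, $e\in\Omega_t$ and all states. Partition Multilinear Extension (PME): $\tilde f_t(\mathbf{x};s_t)=\sum_{A\in\mathcal{I}_t}F_t(A;s_t)\prod_{i\in\mathcal{N}_t}p_i(A;\mathbf{x})$, where $p_i(A;\mathbf{x})=x_{(i,a)}$ if $A\cap\Omega_{i,t}=\{(i,a)\}$ and $p_i(A;\mathbf{x})=1-\sum_{a'}x_{(i,a')}$ if $A\cap\Omega_{i,t}=\emptyset$. $\nabla\tilde f_t$ is the gradient of this polynomial in $\mathbf{x}$. *)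

(* Defs.v *)
From HB Require Import structures.
From mathcomp Require Import all_boot all_order all_algebra.
From mathcomp Require Import all_classical all_reals all_analysis.

Set Implicit Arguments.
Unset Strict Implicit.
Unset Printing Implicit Defensive.

Import Order.TTheory GRing.Theory Num.Theory.
Import numFieldNormedType.Exports.

Local Open Scope ring_scope.

Definition ground (N : finType) (Act : N -> finType) : finType :=
  {i : N & Act i}.

Definition part (N : finType) (Act : N -> finType) (i : N) :
    {set ground Act} :=
  finset (fun e : ground Act => tag e == i).

Definition indep (N : finType) (Act : N -> finType) (A : {set ground Act}) :
    bool :=
  [forall i : N, #|A :&: part Act i| <= 1]%N.

Definition marginal (R : realType) (E : finType) (F : {set E} -> R)
    (e : E) (A : {set E}) : R :=
  F (e |: A)%SET - F A.

Definition set_normalized (R : realType) (E : finType) (F : {set E} -> R) : Prop :=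
  F finset.set0 = 0.

Definition set_monotone (R : realType) (E : finType) (F : {set E} -> R) : Prop :=
  forall A B : {set E}, A \subset B -> F A <= F B.

Definition set_submodular (R : realType) (E : finType) (F : {set E} -> R) : Prop :=
  forall (A B : {set E}) (e : E), A \subset B -> e \notin B ->
    marginal F e B <= marginal F e A.

Definition bounded_marginals (R : realType) (N : finType)
    (Act : N -> finType) (F : {set ground Act} -> R) : Prop :=
  exists B : R, forall (A : {set ground Act}) (e : ground Act),
    indep A -> 0 <= marginal F e A <= B.

(* The default value [F set0] is itself one of the maximized values, since the
   empty set is independent. *)
Definition OPT (R : realType) (N : finType) (Act : N -> finType)
    (F : {set ground Act} -> R) : R :=
  \big[Num.max/F finset.set0]_(A : {set ground Act} | indep A) F A.

Definition agent_mass (R : realType) (N : finType) (Act : N -> finType)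
    (x : {ffun ground Act -> R}) (i : N) : R :=
  \sum_(a : Act i) x (Tagged Act a).

Definition polytope (R : realType) (N : finType) (Act : N -> finType) :
    set {ffun ground Act -> R} :=
  fun x => (forall e, 0 <= x e <= 1) /\ (forall i, agent_mass x i <= 1).

Definition face (R : realType) (N : finType) (Act : N -> finType) :
    set {ffun ground Act -> R} :=
  fun x => polytope x /\ (forall i, agent_mass x i = 1).

(* For independent [A], [A :&: part Act i] has at most one element, so the
   choice made by [pick] is forced. *)
Definition choice_prob (R : realType) (N : finType) (Act : N -> finType)
    (A : {set ground Act}) (x : {ffun ground Act -> R}) (i : N) : R :=
  if [pick e in A :&: part Act i] is Some e then x e
  else 1 - agent_mass x i.

Definition PME (R : realType) (N : finType) (Act : N -> finType)
    (F : {set ground Act} -> R) (x : {ffun ground Act -> R}) : R :=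
  \sum_(A : {set ground Act} | indep A) F A * \prod_(i : N) choice_prob A x i.

Definition grad (R : realType) (E : finType) (f : {ffun E -> R} -> R)
    (x : {ffun E -> R}) : {ffun E -> R} :=
  [ffun e => (fun u : R =>
     f [ffun e' => if e' == e then u else x e'])^`()%classic (x e)].

(* Euclidean norm; the library puts no norm on [{ffun E -> R}]. *)
Definition norm2 (R : realType) (E : finType) (x : {ffun E -> R}) : R :=
  Num.sqrt (\sum_(e : E) x e ^+ 2).

(* Euclidean projection onto [C]: the nearest point, which exists and is unique
   when [C] is nonempty, closed and convex. The default [z] is used only when
   there is no nearest point. *)
Definition euclid_proj (R : realType) (E : finType) (C : set {ffun E -> R})
    (z : {ffun E -> R}) : {ffun E -> R} :=
  xget z (fun p : {ffun E -> R} => C p /\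
    forall q, C q -> norm2 (z - p) <= norm2 (z - q)).

Definition is_maximum (R : realType) (S : set R) (m : R) : Prop :=
  S m /\ ubound S m.

Definition distances (R : realType) (E : finType) (C : set {ffun E -> R}) :
    set R :=
  fun r => exists x y, [/\ C x, C y & r = norm2 (x - y)].

Definition random_vector (R : realType) (d : measure_display)
    (T : measurableType d) (E : finType) (X : T -> {ffun E -> R}) : Prop :=
  forall e, measurable_fun setT (fun w => X w e).

Definition sigma_gen (R : realType) (T I : Type) (X : I -> T -> R) :
    set (set T) :=
  (<<s \bigcup_i preimage_set_system setT (X i) measurable >>)%classic.

Definition sigma_vec (R : realType) (T : Type) (E : finType)
    (X : T -> {ffun E -> R}) : set (set T) :=
  sigma_gen (fun (e : E) (w : T) => X w e).

(* [Y] is a version of the conditional expectation of [X] given the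
   sub-sigma-algebra [G]. *)
Definition is_cond_exp (R : realType) (d : measure_display)
    (T : measurableType d) (P : probability T R) (G : set (set T))
    (X Y : T -> R) : Prop :=
  [/\ P.-integrable setT (EFin \o X),
      P.-integrable setT (EFin \o Y),
      (forall B : set R, measurable B -> G (Y @^-1` B)%classic)
    & forall A : set T, G A ->
        (\int[P]_(w in A) (X w)%:E = \int[P]_(w in A) (Y w)%:E)%E].

Definition uniform_index (R : realType) (d : measure_display)
    (T : measurableType d) (P : probability T R) (K : nat) (k : T -> 'I_K) :
    Prop :=
  forall j : 'I_K, measurable (k @^-1` [set j])%classic /\
    P (k @^-1` [set j])%classic = (K%:R^-1)%:E.

Definition indep_index (R : realType) (d : measure_display)
    (T : measurableType d) (P : probability T R) (K : nat) (k : T -> 'I_K)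
    (G : set (set T)) : Prop :=
  forall (j : 'I_K) (A : set T), G A ->
    P (k @^-1` [set j] `&` A)%classic =
    (P (k @^-1` [set j])%classic * P A)%E.

Definition joint_action (N : finType) (Act : N -> finType)
    (a : {dffun forall i : N, Act i}) : {set ground Act} :=
  finset (fun e : ground Act => e == Tagged Act (a (tag e))).

(* Expectation of [h A] when [A] is drawn from the factorized categorical
   policy with marginal vector [x]: the agents choose independently, agent [i]
   choosing action [a] with probability [x (i, a)]. *)
Definition policy_exp (R : realType) (N : finType) (Act : N -> finType)
    (x : {ffun ground Act -> R}) (h : {set ground Act} -> R) : R :=
  \sum_(a : {dffun forall i : N, Act i})
    (\prod_(i : N) x (Tagged Act (a i))) * h (joint_action a).

(* Main.v *)
Require Import Defs.
From HB Require Import structures.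
From mathcomp Require Import all_boot all_order all_algebra.
From mathcomp Require Import all_classical all_reals all_analysis.
From mathcomp Require Import measurable_realfun ring lra.

(* On the face, the coordinate (i, b) of the gradient of the multilinear
   extension at x is the expected gain of replacing agent i's action by b in a
   joint action A drawn from x, relative to dropping agent i from A. Summing
   over the actions of an optimal joint action O, submodularity gives
   <grad, O> >= F(O) - E F(A); summing over A itself, submodularity and
   F(empty) = 0 give <grad, x> <= E F(A). Hence
   <grad(x), O - x> >= OPT - 2 f(x), an approximate-concavity bound which
   replaces concavity in the textbook analysis of projected stochastic gradient
   ascent: expand |x_{k+1} - O|^2, take expectations and telescope.

   Two points need care. The noise g_k - grad(x_k) must be orthogonal to every
   bounded function of x_k, although the hypotheses only provide vanishing
   integrals over events determined by x_k. And the iterates must be measurable,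
   which follows from the projection being nonexpansive. *)

Set Implicit Arguments.
Unset Strict Implicit.
Unset Printing Implicit Defensive.

Import Order.TTheory GRing.Theory Num.Theory.
Import numFieldNormedType.Exports.

Local Open Scope ring_scope.

(** * Gradient of the multilinear extension *)

Section Independent.
Variables (N : finType) (Act : N -> finType).
Implicit Types (A B : {set ground Act}) (i : N) (e : ground Act).

Lemma in_part e i : (e \in part Act i) = (tag e == i).
Proof. by rewrite inE. Qed.

Lemma indepP A :
  reflect {in A &, forall e e', tag e = tag e' -> e = e'} (indep A).
Proof.
apply: (iffP forallP) => [H e e' eA e'A ee'|H i].
  have /card_le1_eqP He := H (tag e').
  by apply: He; rewrite inE ?eA ?e'A in_part ?ee' eqxx.
apply/card_le1_eqP => e e';
  rewrite !inE => /andP[eA /eqP ei] /andP[e'A /eqP e'i].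
by apply: H => //; rewrite ei e'i.
Qed.

Lemma part_freeP A i :
  reflect {in A, forall e, tag e != i} (A :&: part Act i == finset.set0)%SET.
Proof.
apply: (iffP eqP) => [H e eA|H].
  by apply/negP => ei; have := finset.in_set0 e; rewrite -H inE eA in_part ei.
by apply/setP => e; rewrite !inE; apply/andP => -[/H/negP].
Qed.

Lemma part_free_setD A i :
  A :&: part Act i == finset.set0 -> A :\: part Act i = A.
Proof.
move/part_freeP => H; apply/setP => e; rewrite !inE.
by have [eA|_] := boolP (e \in A); rewrite ?andbF// H.
Qed.

Lemma setU1_setD_part A i (b : Act i) : A :&: part Act i == finset.set0 ->
  (Tagged Act b |: A) :\: part Act i = A.
Proof.
move=> H; rewrite -[RHS](part_free_setD H); apply/setP => e; rewrite !inE.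
by have [->|] := eqVneq e (Tagged Act b); rewrite //= eqxx.
Qed.

Lemma indep_setU1 A i (b : Act i) : A :&: part Act i == finset.set0 ->
  indep (Tagged Act b |: A) = indep A.
Proof.
move/part_freeP => H; apply/indepP/indepP => HA e e' eA e'A.
  by apply: HA; rewrite !inE ?eA ?e'A orbT.
move: eA e'A; rewrite !inE => /predU1P[->|eA] /predU1P[->|e'A] //=.
- by move/esym/eqP; rewrite (negPf (H _ e'A)).
- by move/eqP; rewrite (negPf (H _ eA)).
- exact: HA.
Qed.

(* An independent set either avoids agent [i] or arises in exactly one way by
   adding an action of [i] to an independent set avoiding [i]. *)
Lemma sum_indep_split (V : zmodType) i (H : {set ground Act} -> V) :
  \sum_(A | indep A) H A =
  \sum_(A : {set ground Act} | indep A && (A :&: part Act i == finset.set0))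
    (H A + \sum_(b : Act i) H (Tagged Act b |: A)%SET).
Proof.
rewrite (bigID (fun A : {set ground Act} => A :&: part Act i == finset.set0))
  /=.
rewrite big_split /=; congr (_ + _).
(* Independence leaves exactly one action [b] of agent [i] in such an [A], so the inner sum has a
   single nonzero term, [H A]. *)
transitivity (\sum_(A : {set ground Act} |
    indep A && (A :&: part Act i != finset.set0))
    \sum_(b : Act i) (if Tagged Act b \in A then H A else 0)).
  apply: eq_bigr => A /andP[/indepP Ai /set0Pn[e]]; rewrite inE in_part.
  case: e => j b /= /andP[bA /eqP ji]; case: i / ji.
  rewrite (bigD1 b) //= bA big1 ?addr0// => c cb.
  case: ifP => // cA; have /eqP := Ai _ _ cA bA erefl.
  by rewrite eq_Tagged /= (negPf cb).
rewrite exchange_big /= [RHS]exchange_big /=; apply: eq_bigr => b _.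
rewrite -big_mkcondr /=.
rewrite (reindex_onto (fun B : {set ground Act} => Tagged Act b |: B)
                      (fun A => A :\ Tagged Act b)) /=; last first.
  by move=> A /andP[_ bA]; rewrite finset.setD1K.
apply: eq_bigl => A; apply/idP/idP.
  rewrite finset.setU11 andbT => /andP[/andP[/indepP Ai _] /eqP AE].
  have bA : Tagged Act b \notin A by rewrite -AE !inE eqxx.
  have fA : A :&: part Act i == finset.set0.
    apply/part_freeP => e eA; apply/eqP => ei; move: bA; apply/negP.
    rewrite negbK -(Ai e (Tagged Act b)) ?inE ?eqxx ?eA ?orbT //.
  by rewrite fA andbT -(indep_setU1 b fA); apply/indepP.
move=> /andP[Ai fA]; rewrite indep_setU1// Ai finset.setU11 andbT /=.
have bA : Tagged Act b \notin A.
  by apply/negP => /(part_freeP _ _ fA); rewrite /= eqxx.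
rewrite finset.setU1K// eqxx andbT; apply/set0Pn; exists (Tagged Act b).
by rewrite !inE !eqxx.
Qed.

End Independent.

Section Multilinear.
Variables (R : realType) (N : finType) (Act : N -> finType).
Implicit Types (A B : {set ground Act}) (i : N) (e : ground Act).
Implicit Types (x y : {ffun ground Act -> R}) (h F : {set ground Act} -> R).

Definition others_prob A x i := \prod_(j | j != i) choice_prob A x j.

Lemma choice_prob_free A x i :
  A :&: part Act i == finset.set0 -> choice_prob A x i = 1 - agent_mass x i.
Proof.
by rewrite /choice_prob => /eqP ->; case: pickP => // e; rewrite inE.
Qed.

Lemma choice_prob_mem A x i e : indep A -> e \in A -> tag e = i ->
  choice_prob A x i = x e.
Proof.
move=> /indepP Ai eA ei; rewrite /choice_prob; case: pickP => [e'|/(_ e)].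
  rewrite !inE => /andP[e'A /eqP e'i]; congr (x _).
  by apply: Ai => //; rewrite e'i.
by rewrite !inE eA ei eqxx.
Qed.

Lemma choice_prob_setU1 A x i j (b : Act i) : j != i ->
  choice_prob (Tagged Act b |: A)%SET x j = choice_prob A x j.
Proof.
move=> ji; rewrite /choice_prob.
suff -> : ((Tagged Act b |: A) :&: part Act j)%SET =
  (A :&: part Act j)%SET by [].
apply/setP => e; rewrite !inE; have [->/=|//] := eqVneq e (Tagged Act b).
by rewrite eq_sym (negPf ji) !andbF.
Qed.

(** Grouping the independent sets by what the agents other than [i] choose shows that the extension
    is affine in the coordinates of agent [i], with weights [others_prob] that do not involve
    them. *)
Lemma PME_split i h x :
  PME h x =
  \sum_(A : {set ground Act} | indep A && (A :&: part Act i == finset.set0))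
    others_prob A x i * (h A * (1 - agent_mass x i) +
      \sum_(b : Act i) h (Tagged Act b |: A)%SET * x (Tagged Act b)).
Proof.
rewrite /PME (sum_indep_split i); apply: eq_bigr => A /andP[Ai fA].
rewrite mulrDr mulr_sumr (bigD1 i)//= choice_prob_free// -/(others_prob A x i).
congr (_ + _); first by ring.
apply: eq_bigr => b _; rewrite (bigD1 i)//=.
rewrite (@choice_prob_mem _ _ i (Tagged Act b))//; last 2 first.
  by rewrite indep_setU1.
  by rewrite !inE eqxx.
under eq_bigr => j ji do rewrite choice_prob_setU1//.
by rewrite -/(others_prob A x i); ring.
Qed.

Definition upd x e (u : R) : {ffun ground Act -> R} :=
  [ffun e' => if e' == e then u else x e'].

Lemma others_prob_upd A x i (b : Act i) u :
  others_prob A (upd x (Tagged Act b) u) i = others_prob A x i.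
Proof.
apply: eq_bigr => j ji; rewrite /choice_prob; case: pickP => [e|_].
  rewrite !inE => /andP[_ /eqP ej]; rewrite ffunE; case: eqP => // eb.
  by move: ji; rewrite -ej eb /= eqxx.
congr (1 - _); apply: eq_bigr => c _; rewrite ffunE; case: eqP => // cb.
by have := congr1 tag cb; move/eqP; rewrite /= (negPf ji).
Qed.

(** Removing [part Act i] first makes the gain independent of the action that [A] assigns to agent
    [i]. *)
Definition swap_gain F i (b : Act i) A : R :=
  F (Tagged Act b |: A :\: part Act i) - F (A :\: part Act i).

(** The gain ignores agent [i]'s own choice, whose weights [1 - agent_mass x i] and [x (i, c)] sum
    to one for every [x], on the face or not. *)
Lemma PME_swap_gain F x i (b : Act i) :
  PME (swap_gain F b) x =
  \sum_(A : {set ground Act} | indep A && (A :&: part Act i == finset.set0))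
    others_prob A x i * (F (Tagged Act b |: A)%SET - F A).
Proof.
rewrite (PME_split i); apply: eq_bigr => A /andP[Ai fA]; congr (_ * _).
rewrite /swap_gain part_free_setD//.
under eq_bigr => c _ do rewrite setU1_setD_part//.
by rewrite -mulr_sumr -mulrDr subrK mulr1.
Qed.

(** By [PME_split] the extension is affine in each coordinate; this exact first-order expansion
    turns the derivative in [gradE] into a coefficient. *)
Lemma PME_upd F x i (b : Act i) u :
  PME F (upd x (Tagged Act b) u) =
  PME F x + (u - x (Tagged Act b)) * PME (swap_gain F b) x.
Proof.
rewrite PME_swap_gain !(PME_split i F) mulr_sumr -big_split /=.
apply: eq_bigr => A /andP[Ai fA]; rewrite others_prob_upd.
have sumE (k : Act i -> R) :
  \sum_c k c * upd x (Tagged Act b) u (Tagged Act c) =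
    \sum_c k c * x (Tagged Act c) + k b * (u - x (Tagged Act b)).
  rewrite (bigD1 b)//= [in RHS](bigD1 b)//= ffunE eqxx.
  under eq_bigr => c cb do rewrite ffunE eq_Tagged /= (negPf cb).
  by ring.
have massE : agent_mass (upd x (Tagged Act b) u) i =
    agent_mass x i + (u - x (Tagged Act b)).
  have := sumE (fun=> 1); rewrite mul1r.
  by under eq_bigr do rewrite mul1r; under [in RHS]eq_bigr do rewrite mul1r.
by rewrite sumE massE; ring.
Qed.

Lemma gradE F x i (b : Act i) :
  grad (PME F) x (Tagged Act b) = PME (swap_gain F b) x.
Proof.
rewrite ffunE; set M := PME _ _.
rewrite (_ : (fun u : R => _) =
   (fun u => PME F x + (u - x (Tagged Act b)) * M)); last first.
  by apply/funext => u; exact: PME_upd.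
rewrite derive1E; apply: derive_val; apply: is_derive_eq.
by rewrite /GRing.scale/=; ring.
Qed.

(** Both sides reduce to the same sum over sets avoiding [i]: such a set loses nothing when [i] is
    dropped, and adding [b] to it loses exactly the marginal of [b]. *)
Lemma sum_grad F x i :
  \sum_(b : Act i) x (Tagged Act b) * grad (PME F) x (Tagged Act b) =
  PME (fun A => F A - F (A :\: part Act i)) x.
Proof.
under eq_bigr => b _ do rewrite gradE PME_swap_gain mulr_sumr.
rewrite exchange_big /= (PME_split i); apply: eq_bigr => A /andP[Ai fA].
rewrite part_free_setD// subrr mul0r add0r mulr_sumr; apply: eq_bigr => b _.
by rewrite setU1_setD_part//; ring.
Qed.

Lemma sum_tagged (V : nmodType) (H : ground Act -> V) :
  \sum_e H e = \sum_i \sum_(b : Act i) H (Tagged Act b).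
Proof.
rewrite [RHS](sig_big_dep _ _ (fun i b => H (Tagged Act b)))//=.
by apply: eq_bigr => -[].
Qed.

Lemma joint_action_indep (a : {dffun forall i : N, Act i}) :
  indep (joint_action a).
Proof.
by apply/indepP => -[i b] [j c]; rewrite !inE => /eqP -> /eqP -> /= ->.
Qed.

Lemma mem_joint_action (a : {dffun forall i : N, Act i}) i :
  Tagged Act (a i) \in joint_action a.
Proof. by rewrite inE. Qed.

Lemma sum_prob_policy x :
  \sum_(a : {dffun forall i : N, Act i}) \prod_i x (Tagged Act (a i)) =
  \prod_i agent_mass x i.
Proof.
(* Joint actions are recast as elements of [fprod Act], over which a product of sums expands by
   distributivity. *)
rewrite (reindex _ (onW_bij _ (@dffun_of_fprod_bij _ Act))) /=.
pose p i : {ffun Act i -> R} := [ffun b => x (Tagged Act b)].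
transitivity (\sum_(t : fprod Act) \prod_(i in N) p i (t i)).
  by apply: eq_bigr => t _; apply: eq_bigr => i _; rewrite !ffunE.
rewrite big_fprod.
have := @bigA_distr_big_dep R 0 1 *%R +%R N {i & Act i}
   (fun i => tagged_with Act i) (fun i => untag 0 (p i)).
move=> <-; apply: eq_bigr => i _.
rewrite -(big_tag p); apply: eq_bigr => b _; by rewrite ffunE.
Qed.

Hypothesis Act_nonempty : forall i, (0 < #|Act i|)%N.

(** An arbitrary joint action, consulted only for agents from which [A] contains no action. *)
Let default : {dffun forall i : N, Act i} :=
  [ffun i => xchoose (elimT card_gt0P (Act_nonempty i))].

Let action_of A : {dffun forall i : N, Act i} :=
  [ffun i => odflt (default i) [pick b | Tagged Act b \in A]].

Lemma joint_action_ofK A : indep A ->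
  (forall i, A :&: part Act i != finset.set0) -> joint_action (action_of A) = A.
Proof.
move=> /indepP Ai fA; apply/setP => -[i b]; rewrite inE /= ffunE.
have [c cA] : exists c : Act i, Tagged Act c \in A.
  have /set0Pn[[j c]] := fA i; rewrite !inE /= => /andP[cA /eqP ji].
  by case: i / ji {b}; exists c.
case: pickP => [c' c'A|/(_ c)]; last by rewrite cA.
apply/eqP/idP => [->//|bA]; exact: Ai.
Qed.

Lemma action_ofK (a : {dffun forall i : N, Act i}) :
  action_of (joint_action a) = a.
Proof.
apply/ffunP => i; rewrite ffunE; case: pickP => [b|/(_ (a i))].
  by rewrite inE /= eq_Tagged => /eqP.
by rewrite mem_joint_action.
Qed.

(** Agents missing from [A] receive a default action. With monotonicity, this lets the optimum be
    sought among full joint actions. *)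
Lemma indep_sub_joint_action A : indep A ->
  A \subset joint_action (action_of A).
Proof.
move=> /indepP Ai; apply/fintype.subsetP => -[i b] bA; rewrite inE /= ffunE.
case: pickP => [c cA|/(_ b)]; last by rewrite bA.
by apply/eqP; apply: Ai.
Qed.

(** A set that misses some agent has a factor [1 - 1 = 0]; the remaining independent sets correspond
    bijectively to joint actions. *)
Lemma PME_policy_exp h x : (forall i, agent_mass x i = 1) ->
  PME h x = policy_exp x h.
Proof.
move=> x1; rewrite /PME.
rewrite (bigID (fun A : {set ground Act} =>
  [forall i, A :&: part Act i != finset.set0])) /= [X in _ + X]big1 ?addr0.
  rewrite (reindex_onto (@joint_action N Act) action_of) /=; last first.
    by move=> A /andP[Ai /forallP fA]; exact: joint_action_ofK.
  apply: eq_big => [a|a _].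
    rewrite joint_action_indep action_ofK eqxx andbT /=; apply/forallP => i.
    by apply/set0Pn; exists (Tagged Act (a i));
      rewrite inE mem_joint_action in_part/=.
  rewrite mulrC; congr (_ * _); apply: eq_bigr => i _.
  by apply: choice_prob_mem; rewrite ?joint_action_indep ?mem_joint_action.
move=> A /andP[_ /forallPn[i]]; rewrite negbK => fA.
by rewrite (bigD1 i)//= choice_prob_free// x1 subrr mul0r mulr0.
Qed.

Lemma PME_cst c x : (forall i, agent_mass x i = 1) -> PME (fun=> c) x = c.
Proof.
move=> x1; rewrite PME_policy_exp// /policy_exp -mulr_suml sum_prob_policy.
by rewrite big1 ?mul1r.
Qed.

Lemma OPT_joint_action F : set_monotone F ->
  exists a : {dffun forall i : N, Act i}, OPT F <= F (joint_action a).
Proof.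
move=> Fmono; case: (@arg_maxP _ R _ default xpredT
  (fun a => F (joint_action a)) isT).
move=> a _ amax; exists a; rewrite /OPT; elim/big_ind: _ => [|u v ua va|A Ai].
- by apply: Fmono; rewrite finset.sub0set.
- by rewrite ge_max ua va.
- exact: le_trans (Fmono _ _ (indep_sub_joint_action Ai)) (amax _ isT).
Qed.

End Multilinear.

(** * Submodularity and the approximate-concavity bound *)

Section Gradient.
Variables (R : realType) (N : finType) (Act : N -> finType).
Variable F : {set ground Act} -> R.
Hypotheses (F_normalized : set_normalized F) (F_monotone : set_monotone F).
Hypothesis F_submodular : set_submodular F.
Implicit Types (A B : {set ground Act}).

(** Extends submodularity to [e \in B]: the left side is then zero, and monotonicity makes the right
    side nonnegative. *)
Lemma marginal_anti A B e : A \subset B -> F (e |: B) - F B <= F (e |: A) - F A.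
Proof.
move=> AB; have [eB|eB] := boolP (e \in B); last exact: F_submodular.
rewrite (finset.setUidPr _) ?finset.sub1set// subrr subr_ge0.
by apply: F_monotone; exact: finset.subsetUr.
Qed.

(** The actions of [a] are added to [A] one agent at a time. Each increment is a marginal over a
    superset of [A :\: part Act i], hence at most the swap gain. *)
Lemma sum_swap_gain_ge A (a : {dffun forall i : N, Act i}) :
  F (joint_action a) - F A <= \sum_i swap_gain F (a i) A.
Proof.
pose U (s : seq N) := (A :|:
  finset (fun e => (tag e \in s) && (e \in joint_action a)))%SET.
have H s : F (U s) - F A <= \sum_(i <- s) swap_gain F (a i) A.
  elim: s => [|i s IH].
    rewrite big_nil subr_le0; apply: F_monotone.
    by apply/fintype.subsetP => e; rewrite !inE orbF.
  rewrite big_cons; apply: le_trans (lerD (lexx _) IH).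
  have -> : U (i :: s) = (Tagged Act (a i) |: U s)%SET.
    apply/setP => -[j b]; rewrite !inE /=.
    have [ji|ji] := eqVneq j i; last first.
      by rewrite -tag_eqE /tag_eq /= (negPf ji).
    case: i / ji IH => _ /=; rewrite !eq_Tagged /=.
    by case: (b == a j); rewrite ?andbT ?andbF ?orbT.
  have := @marginal_anti (A :\: part Act i) (U s) (Tagged Act (a i)).
  have -> : A :\: part Act i \subset U s.
    by apply/fintype.subsetP => e; rewrite !inE => /andP[_ ->].
  by move=> /(_ isT); rewrite /swap_gain; lra.
apply: le_trans (H (index_enum N)); rewrite lerD2r; apply: F_monotone.
by apply/fintype.subsetP => e; rewrite !inE mem_index_enum => ->; rewrite orbT.
Qed.

(** [A] is rebuilt from the empty set one agent at a time: agent [i] joins a subset of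
    [A :\: part Act i], so its marginal there is at least the loss, and the marginals telescope from
    [F] of the empty set, which is zero. *)
Lemma sum_loss_le A : indep A -> \sum_i (F A - F (A :\: part Act i)) <= F A.
Proof.
move=> /indepP Ai.
pose S (s : seq N) := (A :&: finset (fun e => tag e \in s))%SET.
have H s : uniq s -> \sum_(i <- s) (F A - F (A :\: part Act i)) <= F (S s).
  elim: s => [_|i s IH /andP[is_ us]].
    by rewrite big_nil -F_normalized; apply: F_monotone; exact: finset.sub0set.
  rewrite big_cons; apply: le_trans (lerD (lexx _) (IH us)) _.
  have [fA|/set0Pn[e]] := boolP (A :&: part Act i == finset.set0).
    rewrite part_free_setD// subrr add0r; apply: F_monotone.
    apply/fintype.subsetP => e; rewrite !inE => /andP[-> ->].
    by rewrite orbT.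
  rewrite inE in_part => /andP[eA /eqP ei].
  have SE : S (i :: s) = (e |: S s)%SET.
    apply/setP => e'; rewrite !inE; have [->|e'e] := eqVneq e' e.
      by rewrite eA ei eqxx.
    have [e'A|//] := boolP (e' \in A); rewrite /=; case: eqP => //= e'i.
    by case/eqP: e'e; apply: Ai => //; rewrite ei.
  have AE : A = (e |: A :\: part Act i)%SET.
    apply/setP => e'; rewrite !inE; have [->//|e'e] := eqVneq e' e.
    have [e'A|] := boolP (e' \in A); rewrite ?andbF// andbT /=.
    apply/esym/eqP => e'i.
    by case/eqP: e'e; apply: Ai => //; rewrite ei.
  have := @marginal_anti (S s) (A :\: part Act i) e.
  have -> : S s \subset A :\: part Act i.
    apply/fintype.subsetP => e'; rewrite !inE => /andP[-> e's].
    by rewrite andbT; apply: contraNneq is_ => <-.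
  by move=> /(_ isT); rewrite -AE -SE; lra.
apply: le_trans (H _ (index_enum_uniq N)) _; apply: F_monotone.
exact: finset.subsetIl.
Qed.

Lemma PME_sum (I : finType) (h : I -> {set ground Act} -> R) x :
  PME (fun A => \sum_i h i A) x = \sum_i PME (h i) x.
Proof.
by rewrite /PME exchange_big /=; apply: eq_bigr => A _; rewrite mulr_suml.
Qed.

Lemma PME_sub (h k : {set ground Act} -> R) x :
  PME (fun A => h A - k A) x = PME h x - PME k x.
Proof. by rewrite /PME -sumrB; apply: eq_bigr => A _; rewrite mulrBl. Qed.

Lemma PME_le (h k : {set ground Act} -> R) x : polytope x ->
  (forall A, indep A -> h A <= k A) -> PME h x <= PME k x.
Proof.
move=> [x01 x1] hk; apply: ler_sum => A Ai; apply: ler_wpM2r (hk A Ai).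
apply: prodr_ge0 => i _; rewrite /choice_prob; case: pickP => [e _|_].
  by have /andP[] := x01 e.
by rewrite subr_ge0.
Qed.

Definition vertex (a : {dffun forall i : N, Act i}) : {ffun ground Act -> R} :=
  [ffun e => (e \in joint_action a)%:R].

Lemma vertex_sum (a : {dffun forall i : N, Act i}) i (k : Act i -> R) :
  \sum_b vertex a (Tagged Act b) * k b = k (a i).
Proof.
rewrite (bigD1 (a i))//= ffunE mem_joint_action mul1r big1 ?addr0// => b ba.
by rewrite ffunE inE /= eq_Tagged /= (negPf ba) mul0r.
Qed.

Lemma vertex_face (a : {dffun forall i : N, Act i}) : face (vertex a).
Proof.
have m1 i : agent_mass (vertex a) i = 1.
  have := vertex_sum a (fun _ : Act i => 1); under eq_bigr do rewrite mulr1.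
  by [].
split=> //; split=> [e|i]; last by rewrite m1.
by rewrite ffunE; case: (_ \in _); rewrite /= ?lexx ?ler01.
Qed.

(** One copy of [PME F x] comes from the gain bound [sum_swap_gain_ge], the other from the loss
    bound [sum_loss_le]; their sum is the source of the factor one half in the theorem. *)
Lemma grad_vertex (Act_nonempty : forall i, (0 < #|Act i|)%N)
    (a : {dffun forall i : N, Act i}) x : face x ->
  F (joint_action a) - 2 * PME F x <=
  \sum_e grad (PME F) x e * (vertex a e - x e).
Proof.
move=> [xP x1].
(* Agent by agent, pairing with the vertex selects the coordinate [a i], and pairing with [x] gives
   the expected loss through [sum_grad]. *)
have -> : \sum_e grad (PME F) x e * (vertex a e - x e) =
    \sum_i (PME (swap_gain F (a i)) x -
      PME (fun A => F A - F (A :\: part Act i)) x).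
  rewrite sum_tagged; apply: eq_bigr => i _.
  rewrite -sum_grad -gradE -(vertex_sum a
    (fun b => grad (PME F) x (Tagged Act b))).
  by rewrite -sumrB; apply: eq_bigr => b _; ring.
rewrite sumrB -!PME_sum.
have H1 : PME (fun A => F (joint_action a) - F A) x <=
    PME (fun A => \sum_i swap_gain F (a i) A) x.
  by apply: PME_le => // A _; exact: sum_swap_gain_ge.
have H2 : PME (fun A => \sum_i (F A - F (A :\: part Act i))) x <= PME F x.
  by apply: PME_le => // A; exact: sum_loss_le.
move: H1; rewrite PME_sub PME_cst//; lra.
Qed.

End Gradient.

(** * Euclidean projection onto the face *)

Section Projection.
Variables (R : realType) (E : finType).
Implicit Types (u v z p q : {ffun E -> R}) (C : set {ffun E -> R}).

Definition dot u v := \sum_e u e * v e.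
Definition sqn u := \sum_e u e ^+ 2.

Lemma sqn_ge0 u : 0 <= sqn u.
Proof. by apply: sumr_ge0 => e _; exact: sqr_ge0. Qed.

Lemma norm2_sqr u : norm2 u ^+ 2 = sqn u.
Proof. by rewrite sqr_sqrtr// sqn_ge0. Qed.

Lemma norm2_le u v : (norm2 u <= norm2 v) = (sqn u <= sqn v).
Proof. by rewrite ler_sqrt// sqn_ge0. Qed.

Definition convex_set C := forall p q t, C p -> C q -> 0 <= t <= 1 ->
  C (p + t *: (q - p)).

Definition nearest C z p :=
  C p /\ forall q, C q -> norm2 (z - p) <= norm2 (z - q).

Lemma sqn_le_coord u e : u e ^+ 2 <= sqn u.
Proof.
rewrite /sqn (bigD1 e)//= lerDl; apply: sumr_ge0 => i _; exact: sqr_ge0.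
Qed.

(* Compare [z - p] with [z - (p + t (q - p))] for a small [t > 0]. *)
Lemma nearest_obtuse C z p q : convex_set C -> nearest C z p -> C q ->
  dot (z - p) (q - p) <= 0.
Proof.
move=> cC [Cp pmin] Cq; rewrite leNgt; apply/negP => a0.
set a := dot _ _ in a0; set b := sqn (q - p).
have b0 : 0 <= b := sqn_ge0 _.
(* This choice gives [0 < t <= 1] and [t * b < a], while minimality of [p] would force
   [2 * a <= t * b]. *)
pose t := a / (a + b + 1).
have ab0 : 0 < a + b + 1 by lra.
have t0 : 0 < t by rewrite divr_gt0.
have t1 : t <= 1 by rewrite ler_pdivrMr//; lra.
have := pmin _ (cC _ _ t Cp Cq _); rewrite (ltW t0) t1 => /(_ isT).
rewrite norm2_le.
have -> : sqn (z - (p + t *: (q - p))) = sqn (z - p) - 2 * t * a + t ^+ 2 * b.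
  rewrite /a /b /sqn /dot !mulr_sumr -sumrB -big_split /=;
    apply: eq_bigr => e _.
  by rewrite !ffunE /GRing.scale/=; ring.
have tE : t * (a + b + 1) = a by rewrite /t divfK// gt_eqF.
move=> H; have : t * (2 * a) <= t * (t * b) by move: H; rewrite expr2; lra.
rewrite ler_pM2l// => H2; have : t * b < a by nra.
lra.
Qed.

(** Expanding the square of [(z - p) + (p - q)], the obtuse angle at [p] makes the cross term
    nonnegative. *)
Lemma nearest_contract C z p q : convex_set C -> nearest C z p -> C q ->
  sqn (p - q) <= sqn (z - q).
Proof.
move=> cC zp Cq; have := nearest_obtuse cC zp Cq.
have -> : sqn (z - q) = sqn (z - p) + sqn (p - q) - 2 * dot (z - p) (q - p).
  rewrite /sqn /dot mulr_sumr -big_split /= -sumrB; apply: eq_bigr => e _.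
  by rewrite !ffunE; ring.
have := sqn_ge0 (z - p); lra.
Qed.

(** The two obtuse-angle inequalities are added to the nonnegativity of the squared norm of
    [(z - z') - (p - p')]. *)
Lemma nearest_nonexpansive C z z' p p' : convex_set C ->
  nearest C z p -> nearest C z' p' -> sqn (p - p') <= sqn (z - z').
Proof.
move=> cC zp zp'; have := nearest_obtuse cC zp zp'.1.
have := nearest_obtuse cC zp' zp.1.
have : 0 <= sqn ((z - z') - (p - p')) := sqn_ge0 _.
have -> : sqn ((z - z') - (p - p')) =
    sqn (z - z') + 2 * dot (z - p) (p' - p) + 2 * dot (z' - p') (p - p') -
      sqn (p - p').
  rewrite /sqn /dot !mulr_sumr -!big_split /= -sumrB; apply: eq_bigr => e _.
  by rewrite !ffunE; ring.
lra.
Qed.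

(* [{ffun E -> R}] carries no topology,
  so closedness and compactness are taken in
   the space of functions [E -> R] with the product topology. *)
Definition coord_closed C :=
  closed ([set f : prod_topology (fun _ : E => R) | C (finfun f)]%classic).

(** The squared distance to [z] is continuous, and [C] is a closed subset of the unit cube, compact
    by Tychonoff. *)
Lemma nearest_exists C z : (exists p, C p) ->
  (forall p, C p -> forall e, 0 <= p e <= 1) -> coord_closed C ->
  exists p, nearest C z p.
Proof.
move=> [p0 Cp0] C01 clC.
pose X : topologicalType := prod_topology (fun _ : E => R).
pose K := [set f : X | C (finfun f)]%classic.
pose h (f : X) : R := \sum_e (z e - proj e f) ^+ 2.
have hc : continuous h.
  apply: (@continuous_big _ _ +%R 0 xpredT) => [|e _];
    first exact: add_continuous.
  move=> f; have c : {for f, continuous (fun f : X => z e - proj e f)}.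
    have pc : {for f, continuous (proj e : X -> R)} by exact: proj_continuous.
    exact: (@cvgB R R^o X _ _ (fun=> z e) (proj e) (z e) (proj e f)
      (cvg_cst (z e)) pc).
  exact: (cvgM c c).
have K0 : (K !=set0)%classic.
  exists (fun e => p0 e); rewrite /K /=.
  by rewrite (_ : finfun _ = p0)//; apply/ffunP => e; rewrite ffunE.
have cK : compact K.
  apply: (subclosed_compact clC
    (@tychonoff E (fun=> R) (fun=> `[0, 1]%classic) _)).
    by move=> e; exact: segment_compact.
  by move=> f /= /C01 H e; have := H e; rewrite ffunE in_itv.
have [f] := compact_EVT_min K0 cK (continuous_subspaceT hc).
rewrite inE => Kf fmin; exists (finfun f); split=> // q Cq; rewrite norm2_le.
have := fmin (fun e => q e); rewrite inE /K /= => H.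
have : h f <= h (fun e => q e).
  by apply: H; rewrite (_ : finfun _ = q)//; apply/ffunP => e; rewrite ffunE.
rewrite /h /sqn; congr (_ <= _); apply: eq_bigr => e _; by rewrite !ffunE.
Qed.

Lemma euclid_projP C z : (exists p, nearest C z p) ->
  nearest C z (euclid_proj C z).
Proof. exact: xgetPex. Qed.

End Projection.

Section Face.
Variables (R : realType) (N : finType) (Act : N -> finType).

Lemma face_convex : convex_set (@face R N Act).
Proof.
move=> p q t [[p01 _] p1] [[q01 _] q1] /andP[t0 t1].
have m1 i : agent_mass (p + t *: (q - p)) i = 1.
  have -> : agent_mass (p + t *: (q - p)) i =
      agent_mass p i + t * (agent_mass q i - agent_mass p i).
    rewrite /agent_mass -sumrB mulr_sumr -big_split /=; apply: eq_bigr => b _.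
    by rewrite !ffunE.
  by rewrite p1 q1 subrr mulr0 addr0.
split=> //; split=> [e|i]; last by rewrite m1.
have /andP[? ?] := p01 e; have /andP[? ?] := q01 e.
by rewrite !ffunE /GRing.scale/=; apply/andP; split; nra.
Qed.

Lemma face_closed : coord_closed (@face R N Act).
Proof.
pose X : topologicalType := prod_topology (fun _ : ground Act => R).
rewrite /coord_closed [Y in closed Y](_ : _ =
  ((\bigcap_e [set f : X | 0 <= (proj e f : R) <= 1]) `&`
   \bigcap_i [set f : X | \sum_(b : Act i) (proj (Tagged Act b) f : R) =
     1%R])%classic); last first.
  apply/seteqP; split=> [f [[f01 _] f1]|f [f01 f1]].
    split=> [e _|i _] /=; first by have := f01 e; rewrite ffunE.
    by rewrite -[RHS](f1 i); apply: eq_bigr => b _; rewrite ffunE.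
  have m1 i : agent_mass (finfun f) i = 1.
    by rewrite -[RHS](f1 i I); apply: eq_bigr => b _; rewrite ffunE.
  split=> //; split=> [e|i]; last by rewrite m1.
  by have := f01 e I; rewrite /= ffunE.
apply: closedI.
  apply: closed_bigI => e _.
  rewrite (_ : mkset _ = (proj e : X -> R) @^-1` `[0, 1])%classic; last first.
    by apply/seteqP; split=> f; rewrite /= in_itv.
  apply: (@preimage_closed X R (proj e) `[0, 1]%classic).
    by move=> f _; exact: proj_continuous.
  exact: itv_closed.
apply: closed_bigI => i _.
apply: (@preimage_closed X R
  (fun f : X => \sum_(b : Act i) (proj (Tagged Act b) f : R))
    [set y | y = 1]%classic).
  move=> f _; move: f; apply: (@continuous_big _ _ +%R 0 xpredT) => [|b _].
    exact: add_continuous.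
  exact: proj_continuous.
exact: closed_eq.
Qed.

Lemma face_nearest (x0 z : {ffun ground Act -> R}) : face x0 ->
  nearest (@face R N Act) z (euclid_proj (@face R N Act) z).
Proof.
move=> x0F; apply: euclid_projP; apply: nearest_exists; first by exists x0.
- by move=> p [[]].
- exact: face_closed.
Qed.

End Face.

(** * Measurability of the projection *)

Section Measurability.
Variables (R : realType) (E : finType) (d : measure_display)
  (T : measurableType d).

(** Open upper rays generate the Borel sets, so it suffices to treat superlevel sets of [phi], which
    the first hypothesis makes open for the maximum distance. *)
Lemma lower_semicontinuous_measurable (phi : {ffun E -> R} -> R)
    (z : T -> {ffun E -> R}) :
  (forall u a, a < phi u -> exists2 r, 0 < r &
    forall v : {ffun E -> R}, (forall e, `|v e - u e| < r) -> a < phi v) ->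
  random_vector z -> measurable_fun setT (phi \o z).
Proof.
move=> lsc mz; apply: (measurability _ (RGenOInfty.measurableE R)) => //.
move=> /= _ [_ [a ->] <-]; rewrite setTI.
pose good (qs : {ffun E -> rat} * rat) :=
  forall v : {ffun E -> R}, (forall e, `|v e - ratr (qs.1 e)| < ratr qs.2) ->
    a < phi v.
(* A set open in the sense of [lsc] is a countable union of rational boxes. *)
rewrite [X in measurable X](_ : _ = \bigcup_(qs : {ffun E -> rat} * rat)
  ([set w | good qs] `&` \bigcap_(e in [set: E])
     [set w | `|z w e - ratr (qs.1 e)| < ratr qs.2]))%classic; last first.
  apply/seteqP; split=> [w|w [qs _ [gqs H]]] /=; last first.
    by rewrite in_itv /= andbT; apply: gqs => e; exact: H.
  rewrite in_itv /= andbT => /lsc[r r0 Hr].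
  (* A box of radius [s < r / 2] whose centre is within [s] of [z w] contains [z w] and stays within
     distance [r] of it. *)
  have [s] : exists s : rat, (ratr s : R) \in `]0, (r / 2)[%R.
    by apply: rat_in_itvoo; rewrite divr_gt0.
  rewrite in_itv /= => /andP[s0 sr].
  have /choice[q qP] : forall e, exists q : rat, (ratr q : R) \in `](z w e),
    (z w e + ratr s)[%R.
    by move=> e; apply: rat_in_itvoo; rewrite ltrDl.
  exists (finfun q, s) => //; split=> /=.
    move=> v vq; apply: Hr => e; have := vq e; have := qP e.
    by rewrite in_itv /= ffunE => /andP[? ?]; rewrite !ltr_norml => /andP[? ?];
      apply/andP; split; lra.
  move=> e _ /=; have := qP e; rewrite in_itv /= ffunE ltr_norml => /andP[? ?].
  by apply/andP; split; lra.
apply: countable_bigcupT_measurable => [|[q s]]; first exact: countableP.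
apply: measurableI.
  (* [good] does not depend on [w], so this set is either everything or empty. *)
  by have [g|g] := pselect (good (q, s));
    [rewrite (_ : mkset _ = setT)//|rewrite (_ : mkset _ = set0)//];
   apply/seteqP; split.
apply: fin_bigcap_measurable => [|e _]; first exact: finite_finset.
rewrite (_ : mkset _ = (fun w => `|z w e - ratr (q e)|) @^-1` `]-oo,
  (ratr s)[)%classic; last first.
  by apply/seteqP; split=> w /=; rewrite in_itv.
rewrite -[X in measurable X]setTI.
have : measurable_fun setT (fun w => `|z w e - ratr (q e)|).
  by apply: measurableT_comp => //; apply: measurable_funB => //; exact: mz.
by apply => //; exact: measurable_itv.
Qed.

End Measurability.

(** Each coordinate of the projection is continuous because the projection is nonexpansive, hence
    lower semicontinuous. *)
Lemma random_vector_proj (R : realType) (N : finType) (Act : N -> finType)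
    (d : measure_display) (T : measurableType d) (x0 : {ffun ground Act -> R})
    (z : T -> {ffun ground Act -> R}) : face x0 -> random_vector z ->
  random_vector (fun w => euclid_proj (@face R N Act) (z w)).
Proof.
move=> x0F mz e.
apply: (@lower_semicontinuous_measurable _ _ _ _
  (fun u => euclid_proj (@face R N Act) u e)) => // u a au.
(* With [n] coordinates each moving by less than [(c - a) / (n + 1)], the squared displacement stays
   strictly below [(c - a) ^+ 2]; the added one also covers [n = 0]. *)
pose m : R := #|ground Act|%:R + 1; have m0 : 0 < m by rewrite ltr_wpDl.
set c := euclid_proj _ u e in au *.
exists ((c - a) / m) => [|v vu]; first by rewrite divr_gt0// subr_gt0.
have H := nearest_nonexpansive (@face_convex _ _ _) (face_nearest v x0F)
  (face_nearest u x0F).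
have {H} := le_trans (sqn_le_coord _ e) H; rewrite !ffunE -/c.
set c' := euclid_proj _ v e => H; rewrite ltNge; apply/negP => c'a.
have : sqn (v - u) <= \sum_(e' : ground Act) ((c - a) / m) ^+ 2.
  apply: ler_sum => e' _; rewrite !ffunE -real_normK ?num_real//.
  by rewrite ler_pXn2r ?nnegrE// ?ltW// divr_gt0// subr_gt0.
rewrite sumr_const -mulr_natl => H2.
have k0 : 0 <= #|ground Act|%:R :> R by [].
have : #|ground Act|%:R * ((c - a) / m) ^+ 2 < (c - a) ^+ 2.
  rewrite expr_div_n mulrCA gtr_pMr ?exprn_gt0 ?subr_gt0//.
  by rewrite ltr_pdivrMr ?exprn_gt0// mul1r /m; nra.
nra.
Qed.

(** * Orthogonality of the noise *)

Section Orthogonality.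
Variables (R : realType) (d : measure_display) (T : measurableType d).
Variable P : probability T R.
Implicit Types (f h Z : T -> R).

Notation intble f := (P.-integrable setT (EFin \o f)).

Lemma bounded_integrable f (M : R) : measurable_fun setT f ->
  (forall w, `|f w| <= M) -> intble f.
Proof.
move=> mf fM.
have iM : intble (cst M) by exact: finite_measure_integrable_cst.
apply: le_integrable iM => //; first exact/measurable_EFinP.
by move=> w _ /=; rewrite lee_fin (le_trans (fM w))// ler_norm.
Qed.

Lemma bounded_mul_integrable h Z (M : R) : measurable_fun setT h ->
  (forall w, `|h w| <= M) -> intble Z -> intble (fun w => h w * Z w).
Proof.
move=> mh hM iZ.
have iMZ := integrableZl measurableT M iZ.
apply: le_integrable iMZ => //.
  apply/measurable_EFinP; apply: measurable_funM => //.
  exact/measurable_EFinP/(measurable_int P).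
move=> w _ /=; rewrite lee_fin !normrM ler_wpM2r//.
by rewrite (le_trans (hM w))// ler_norm.
Qed.

Lemma integrable_add f h : intble f -> intble h -> intble (fun w => f w + h w).
Proof. by move=> fi hi; exact: (integrableD measurableT fi hi). Qed.

Lemma integrable_sub f h : intble f -> intble h -> intble (fun w => f w - h w).
Proof. by move=> fi hi; exact: (integrableB measurableT fi hi). Qed.

Lemma integrable_scale (c : R) f : intble f -> intble (fun w => c * f w).
Proof. by move=> /(integrableZl measurableT c). Qed.

Lemma integrable_bigsum (I : Type) (s : seq I) (f : I -> T -> R) :
  (forall i, intble (f i)) -> intble (fun w => \sum_(i <- s) f i w).
Proof.
move=> fi; elim: s => [|i s IH].
  under [X in EFin \o X]eq_fun do rewrite big_nil.
  exact: finite_measure_integrable_cst.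
under [X in EFin \o X]eq_fun do rewrite big_cons.
exact: integrable_add.
Qed.

Lemma Rintegral_bigsum (I : Type) (s : seq I) (f : I -> T -> R) :
  (forall i, intble (f i)) ->
  \int[P]_w (\sum_(i <- s) f i w) = \sum_(i <- s) \int[P]_w f i w.
Proof.
move=> fi; elim: s => [|i s IH].
  under eq_Rintegral do rewrite big_nil.
  by rewrite Rintegral_cst// mul0r big_nil.
under eq_Rintegral do rewrite big_cons.
rewrite RintegralD//; first by rewrite IH big_cons.
exact: integrable_bigsum.
Qed.

Lemma Rintegral_const (c : R) : \int[P]_w c = c.
Proof. by rewrite Rintegral_cst//= [X in fine X]probability_setT mulr1. Qed.

(* [h] is measurable for a sub-sigma-algebra on which [Z] integrates to zero. *)
Definition null_on_preimages Z h := forall B : set R, measurable B ->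
  measurable (h @^-1` B)%classic /\ \int[P]_(w in (h @^-1` B)%classic) Z w = 0.

Lemma null_on_preimages_comp Z h (phi : R -> R) : measurable_fun setT phi ->
  null_on_preimages Z h -> null_on_preimages Z (phi \o h).
Proof.
by move=> mphi nh B mB; rewrite comp_preimage; apply: nh;
  rewrite -[X in measurable X]setTI; exact: mphi.
Qed.

Lemma null_measurable Z h : null_on_preimages Z h -> measurable_fun setT h.
Proof. by move=> nh _ B mB; rewrite setTI; case: (nh B mB). Qed.

(* Peeling off [eps * 1_{h >= eps}], which is orthogonal to [Z], lowers the
   range of [h] by [eps]; after [n] steps only [h <= eps] remains. *)
Lemma null_range_bound Z (eps : R) n h : 0 < eps -> intble Z ->
  null_on_preimages Z h -> (forall w, 0 <= h w <= n.+1%:R * eps) ->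
  `|\int[P]_w (h w * Z w)| <= eps * \int[P]_w `|Z w|.
Proof.
move=> eps0 iZ; elim: n h => [|n IH] h nh h01.
  have mh := null_measurable nh.
  have hb w : `|h w| <= eps.
    by have /andP[h0 h1] := h01 w; rewrite ger0_norm// -[eps]mul1r.
  have ihZ := bounded_mul_integrable mh hb iZ.
  apply: le_trans (le_normr_Rintegral measurableT ihZ) _.
  rewrite -RintegralZl//; last exact: integrable_norm.
  apply: le_Rintegral => //; first exact: integrable_norm.
    by apply: integrable_scale; exact: integrable_norm.
  by move=> w _; rewrite normrM ler_wpM2r.
pose S := `[eps, +oo[%classic : set R.
pose phi (u : R) : R := u - eps * \1_S u.
have mS : measurable S by exact: measurable_itv.
have mphi : measurable_fun setT phi.
  apply: measurable_funB => //; apply: measurable_funM => //.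
have nphi := null_on_preimages_comp mphi nh.
have phi01 w : 0 <= (phi \o h) w <= n.+1%:R * eps.
  have /andP[h0 h1] := h01 w;
    rewrite /phi /= indicE mem_setE /S in_itv /= andbT.
  move: h1; rewrite -[n.+2%:R]natr1 mulrDl mul1r => h1.
  have : 0 <= n%:R * eps by rewrite mulr_ge0// ltW.
  move: h1; rewrite -[n.+1%:R]natr1 mulrDl mul1r.
  by case: (leP eps (h w)) => /= ? ? ?; apply/andP; split; lra.
have phib w : `|(phi \o h) w| <= n.+1%:R * eps.
  by have /andP[? ?] := phi01 w; rewrite ger0_norm.
have [mA A0] := nh S mS.
suff -> : \int[P]_w (h w * Z w) = \int[P]_w ((phi \o h) w * Z w) by exact: IH.
rewrite Rintegral_mkcond patch_indic in A0.
have i1 : intble (fun w => Z w * \1_(h @^-1` S)%classic w).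
  under [X in EFin \o X]eq_fun do rewrite mulrC.
  apply: (@bounded_mul_integrable _ _ 1) => //.
  by move=> w; rewrite indicE; case: (_ \in _); rewrite ?normr1 ?normr0.
transitivity (\int[P]_w ((phi \o h) w * Z w +
  eps * (Z w * \1_(h @^-1` S)%classic w))).
  apply: eq_Rintegral => w _; rewrite /phi /= !indicE !mem_setE /=; ring.
rewrite RintegralD//; last exact: integrable_scale.
  by rewrite RintegralZl// A0 mulr0 addr0.
exact: (bounded_mul_integrable (null_measurable nphi) phib).
Qed.

(** [Z] has integral zero, so [h] may be replaced by the nonnegative [h + M]; then
    [null_range_bound] applies with arbitrarily small [eps]. *)
Lemma null_orthogonal Z h (M : R) : intble Z -> null_on_preimages Z h ->
  (forall w, `|h w| <= M) -> \int[P]_w (h w * Z w) = 0.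
Proof.
move=> iZ nh hM.
have Z0 : \int[P]_w Z w = 0 by have [_] := nh setT measurableT;
  rewrite preimage_setT.
have mh := null_measurable nh.
have M0 : 0 <= M by apply: le_trans (hM point).
have -> : \int[P]_w (h w * Z w) = \int[P]_w ((h w + M) * Z w).
  under [RHS]eq_Rintegral do rewrite mulrDl.
  rewrite RintegralD//; last exact: integrable_scale.
    by rewrite RintegralZl// Z0 mulr0 addr0.
  exact: bounded_mul_integrable hM iZ.
set a := Rintegral _ _ _; set c := \int[P]_w `|Z w|.
have c0 : 0 <= c by exact: Rintegral_ge0.
apply/eqP; rewrite -normr_eq0 eq_le normr_ge0 andbT leNgt; apply/negP => a0.
(* Chosen so that [eps * c < |a|], contradicting the bound of [null_range_bound]; the added one
   handles [c = 0]. *)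
pose eps := `|a| / (c + 1).
have eps0 : 0 < eps by rewrite divr_gt0// ltr_wpDl.
(* The values of [h + M] lie between [0] and [2 * M], which [n.+1] layers of height [eps] must
   cover. *)
have [n nP] : exists n, 2 * M <= n.+1%:R * eps.
  exists (Num.Def.truncn (2 * M / eps)).
  by rewrite -ler_pdivrMr// ltW// truncnS_gt.
have : `|a| <= eps * c.
  apply: (@null_range_bound _ _ n) => //.
    apply: (@null_on_preimages_comp _ _ (fun u => u + M)) => //.
    exact: measurable_funD.
  by move=> w; have := hM w; rewrite ler_norml => /andP[? ?]; apply/andP;
    split; lra.
have : eps * (c + 1) = `|a| by rewrite /eps divfK// gt_eqF// ltr_wpDl.
by rewrite mulrDr mulr1; lra.
Qed.

Lemma cond_exp_null (G : set (set T)) X Y h :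
  (forall A, G A -> measurable A) -> is_cond_exp P G X Y ->
  (forall B : set R, measurable B -> G (h @^-1` B)%classic) ->
  intble (fun w => X w - Y w) /\ null_on_preimages (fun w => X w - Y w) h.
Proof.
move=> Gm [iX iY _ XY] hG; split; first exact: integrable_sub.
move=> B mB; have GA := hG B mB; have mA := Gm _ GA; split=> //.
rewrite RintegralB//; last 2 first.
- by apply: integrableS iX.
- by apply: integrableS iY.
by rewrite /Rintegral XY// subrr.
Qed.

(** On the whole space [X] and [V] have the same integral. As [V <= c] holds only almost everywhere,
    [V] is replaced by [Num.min (V w) c], which has that integral too and is bounded by [c]
    everywhere. *)
Lemma cond_exp_le (G : set (set T)) X V (c : R) : G setT ->
  is_cond_exp P G X V ->
  {ae P, forall w, V w <= c} -> \int[P]_w X w <= c.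
Proof.
move=> GT [iX iV _ XV] Vc.
have mV : measurable_fun setT V by exact/measurable_EFinP/(measurable_int P).
have mm : measurable_fun setT (fun w => Num.min (V w) c) by exact:
  measurable_minr.
have VE : \int[P]_w V w = \int[P]_w Num.min (V w) c.
  congr fine; apply: ae_eq_integral => //; [exact/measurable_EFinP..|].
  by apply: filterS Vc => w Vw _; rewrite min_l.
have im : intble (fun w => Num.min (V w) c).
  have := integrable_add (integrable_norm iV)
    (@finite_measure_integrable_cst _ T R P setT `|c| measurableT).
  apply: le_integrable => //; first exact/measurable_EFinP.
  move=> w _ /=; rewrite lee_fin [leRHS]ger0_norm ?addr_ge0//.
  by rewrite minEle; case: ifP => _; rewrite ?lerDl ?lerDr.
rewrite /Rintegral XV// -/(Rintegral P setT V) VE -[leRHS]Rintegral_const.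
apply: le_Rintegral => //; first exact: finite_measure_integrable_cst.
by move=> w _; rewrite ge_min lexx orbT.
Qed.

End Orthogonality.

(** * Events generated by random variables *)

Section SigmaGen.
Variables (R : realType) (d : measure_display) (T : measurableType d).

Lemma sigma_gen_measurable (I : Type) (X : I -> T -> R) :
  (forall i, measurable_fun setT (X i)) ->
  forall A, sigma_gen X A -> measurable A.
Proof.
move=> mX; apply: smallest_sub; first exact: sigma_algebra_measurable.
by move=> A [i _ [B mB <-]]; exact: mX.
Qed.

Lemma sigma_gen_setT (I : Type) (X : I -> T -> R) : sigma_gen X setT.
Proof.
by rewrite -(setD0 setT); apply: sigma_algebraCD; exact: sigma_algebra0.
Qed.

Lemma sigma_gen_coord (I : Type) (X : I -> T -> R) i (B : set R) :
  measurable B -> sigma_gen X (X i @^-1` B)%classic.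
Proof.
move=> mB; apply: sub_sigma_algebra; exists i => //.
by exists B => //; rewrite setTI.
Qed.

End SigmaGen.

(** * Projected stochastic gradient ascent *)

Section Ascent.
Variables (R : realType) (N : finType) (Act : N -> finType).
Hypothesis Act_nonempty : forall i, (0 < #|Act i|)%N.
Variable F : {set ground Act} -> R.
Hypotheses (F_ge0 : forall A, 0 <= F A) (F_monotone : set_monotone F).
Implicit Types (x y g : {ffun ground Act -> R}).

Lemma PME_ge0_le x : face x -> 0 <= PME F x <= F [set: ground Act]%SET.
Proof.
move=> [xP x1]; apply/andP; split.
  by rewrite -[leLHS](PME_cst Act_nonempty 0 x1); apply: PME_le.
rewrite -[leRHS](PME_cst Act_nonempty _ x1).
by apply: PME_le => // A _; apply: F_monotone; exact: finset.subsetT.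
Qed.

Lemma measurable_PME d (T : measurableType d) (z : T -> {ffun ground Act -> R})
  :
  random_vector z -> measurable_fun setT (fun w => PME F (z w)).
Proof.
move=> mz; rewrite /PME; under eq_fun do rewrite big_mkcond /=.
apply: measurable_sum => A; case: (indep A) => //; apply: measurable_funM => //.
apply: measurable_prod => i _; rewrite /choice_prob; case: pickP => [e _|_] //.
by apply: measurable_funB => //; exact: measurable_sum.
Qed.

(** A crude bound, one unit per coordinate, that serves to make squared distances integrable. *)
Lemma face_diameter x y : face x -> face y -> 0 <= sqn (x - y) <=
  #|ground Act|%:R.
Proof.
move=> [[x01 _] _] [[y01 _] _]; rewrite sqn_ge0 /=.
rewrite -[_%:R]mulr1 mulr_natl -sumr_const; apply: ler_sum => e _;
  rewrite !ffunE.
have /andP[? ?] := x01 e; have /andP[? ?] := y01 e; nra.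
Qed.

(** Projection does not increase the distance to [y]; the square is then expanded around the true
    gradient. The final sum collects the terms linear in the noise, which vanish in expectation. *)
Lemma ascent_step (eta V G : R) x y g : 0 <= eta -> face x -> face y ->
  V - 2 * PME F x <= \sum_e grad (PME F) x e * (y e - x e) ->
  norm2 (grad (PME F) x) <= G ->
  sqn (euclid_proj (@face R N Act) (x + eta *: g) - y) <=
  sqn (x - y) + (4 * eta * PME F x + (eta ^+ 2 * sqn (g - grad (PME F) x) +
  ((eta ^+ 2 * G ^+ 2 - 2 * eta * V) +
  \sum_e (2 * eta * ((x e - y e) * (g e - grad (PME F) x e)) +
     2 * eta ^+ 2 * (grad (PME F) x e * (g e - grad (PME F) x e)))))).
Proof.
move=> eta0 xF yF HV HG; set D := grad (PME F) x in HV HG *.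
apply: le_trans (nearest_contract (@face_convex _ _ _) (face_nearest _ xF) yF)
  _.
have -> : sqn (x + eta *: g - y) = sqn (x - y) -
    2 * eta * (\sum_e D e * (y e - x e)) + eta ^+ 2 * sqn (g - D) + eta ^+
      2 * sqn D +
    \sum_e (2 * eta * ((x e - y e) * (g e - D e)) + 2 * eta ^+
      2 * (D e * (g e - D e))).
  rewrite /sqn !mulr_sumr -sumrB -!big_split /=; apply: eq_bigr => e _.
  by rewrite !ffunE /GRing.scale/=; ring.
have D2 : sqn D <= G ^+ 2.
  by rewrite -norm2_sqr ler_pXn2r ?nnegrE ?sqrtr_ge0//
    (le_trans (sqrtr_ge0 _) HG).
have := ler_wpM2l (sqr_ge0 eta) D2; have := ler_wpM2l eta0 HV; lra.
Qed.

Section Expectation.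
Variables (d : measure_display) (T : measurableType d) (P : probability T R).

Lemma expected_ascent_step (eta V G sigma : R) y
  (x g : T -> {ffun ground Act -> R}) :
  0 <= eta -> face y -> (forall w, face (x w)) ->
  (forall w, V - 2 * PME F (x w) <=
     \sum_e grad (PME F) (x w) e * (y e - x w e)) ->
  (forall z, face z -> norm2 (grad (PME F) z) <= G) ->
  random_vector x -> random_vector g ->
  (forall e, is_cond_exp P (sigma_vec x)
     (fun w => g w e) (fun w => grad (PME F) (x w) e)) ->
  (exists W : T -> R, is_cond_exp P (sigma_vec x)
     (fun w => norm2 (g w - grad (PME F) (x w)) ^+ 2) W /\
     {ae P, forall w, W w <= sigma ^+ 2}) ->
  \int[P]_w sqn (euclid_proj (@face R N Act) (x w + eta *: g w) - y) <=
  \int[P]_w sqn (x w - y) + 4 * eta * \int[P]_w PME F (x w) +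
    (eta ^+ 2 * (G ^+ 2 + sigma ^+ 2) - 2 * eta * V).
Proof.
move=> eta0 yF xF HV HG mx mg unb [W [cW Ws]].
have x01 w e : 0 <= x w e <= 1 by have [[]] := xF w.
have y01 e : 0 <= y e <= 1 by have [[]] := yF.
have sm A : sigma_vec x A -> measurable A.
  by apply: sigma_gen_measurable => e; exact: mx.
have measurable_sqn (z : T -> {ffun ground Act -> R}) : random_vector z ->
  measurable_fun setT (fun w => sqn (z w - y)).
  move=> mz; apply: measurable_sum => e; under eq_fun do rewrite !ffunE.
  by apply: measurable_funX; apply: measurable_funB => //; exact: mz.
have sqn_int z : random_vector z -> (forall w, face (z w)) ->
    P.-integrable setT (EFin \o (fun w => sqn (z w - y))).
  move=> mz zF; apply: (@bounded_integrable _ _ _ P _ #|ground Act|%:R) =>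
    [|w]; first exact: measurable_sqn.
  have /andP[s0 s1] := face_diameter (zF w) yF; rewrite ger0_norm//; exact: s1.
pose zeta e w := g w e - grad (PME F) (x w) e.
(* First cross term: the noise against a function of [x] bounded by one. *)
have zx e : P.-integrable setT (EFin \o (fun w => (x w e - y e) * zeta e w)) /\
    \int[P]_w ((x w e - y e) * zeta e w) = 0.
  have [iz nz] : P.-integrable setT (EFin \o zeta e) /\
      null_on_preimages P (zeta e) (fun w => x w e - y e).
    have coord_gen (B : set R) : measurable B ->
        sigma_vec x ((fun w => x w e) @^-1` B)%classic.
      exact: (@sigma_gen_coord R d T _ (fun e w => x w e) e B).

    have [iz nz] := cond_exp_null sm (unb e) coord_gen.
    split=> //; apply: (null_on_preimages_comp (phi := fun u => u - y e) _ nz).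
    exact: measurable_funB.
  have b1 w : `|x w e - y e| <= 1.
    have /andP[? ?] := x01 w e; have /andP[? ?] := y01 e.
    by rewrite ler_norml; apply/andP; split; lra.
  split; last exact: null_orthogonal nz b1.
  exact: bounded_mul_integrable (null_measurable nz) b1 iz.
(* Second cross term: the gradient coordinate is bounded by [G], and its measurability for
   [sigma_vec x] is part of [is_cond_exp]. *)
have zg e : P.-integrable setT
  (EFin \o (fun w => grad (PME F) (x w) e * zeta e w)) /\
    \int[P]_w (grad (PME F) (x w) e * zeta e w) = 0.
  have [_ _ hG _] := unb e; have [iz nz] := cond_exp_null sm (unb e) hG.
  have b1 w : `|grad (PME F) (x w) e| <= G.
    apply: le_trans (HG _ (xF w)).
    by rewrite -[leLHS]ger0_norm// -sqrtr_sqr ler_sqrt ?sqn_ge0// real_normK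
      ?num_real// sqn_le_coord.
  split; last exact: null_orthogonal nz b1.
  exact: bounded_mul_integrable (null_measurable nz) b1 iz.
have iPME : P.-integrable setT (EFin \o (fun w => PME F (x w))).
  apply: (@bounded_integrable _ _ _ P _ (F [set: ground Act]%SET)) => [|w];
    first exact: measurable_PME.
  by have /andP[? ?] := PME_ge0_le (xF w); rewrite ger0_norm.
have E2 : (fun w => norm2 (g w - grad (PME F) (x w)) ^+ 2) =
    (fun w => sqn (g w - grad (PME F) (x w))).
  by apply/funext => w; rewrite norm2_sqr.
rewrite E2 in cW; have [isq _ _ _] := cW.
have vle := cond_exp_le (@sigma_gen_setT R d T _ (fun e w => x w e)) cW Ws.
(* An opaque [c] keeps the deterministic terms together as one constant under the integral. *)
have [c cE] : exists c : R, c = eta ^+ 2 * G ^+ 2 - 2 * eta * V by eexists.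
pose cross e w := 2 * eta * ((x w e - y e) * zeta e w) +
  2 * eta ^+ 2 * (grad (PME F) (x w) e * zeta e w).
have icross e : P.-integrable setT (EFin \o cross e).
  by apply: integrable_add; apply: integrable_scale;
    [case: (zx e)|case: (zg e)].
have cross0 : \int[P]_w (\sum_e cross e w) = 0.
  rewrite Rintegral_bigsum// big1// => e _; have [i1 E1] := zx e;
    have [i3 E3] := zg e.
  rewrite RintegralD//; [|exact: integrable_scale..].
  by rewrite !RintegralZl// E1 E3 !mulr0 addr0.
have isum : P.-integrable setT (EFin \o (fun w => c + \sum_e cross e w)).
  by apply: integrable_add;
    [exact: finite_measure_integrable_cst|exact: integrable_bigsum].
have i2 := integrable_add (integrable_scale (eta ^+ 2) isq) isum.
have i3 := integrable_add (integrable_scale (4 * eta) iPME) i2.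
have ix := sqn_int _ mx xF.
apply: le_trans (_ : _ <= \int[P]_w (sqn (x w - y) + (4 * eta * PME F (x w) +
   (eta ^+ 2 * sqn (g w - grad (PME F) (x w)) + (c + \sum_e cross e w))))) _.
  apply: le_Rintegral => //.
  - apply: sqn_int => [|w];
    last by have [] := face_nearest (x w + eta *: g w) yF.
    apply: (random_vector_proj yF) => e; under eq_fun do rewrite !ffunE.
    by apply: measurable_funD; [exact: mx|apply: measurable_funM => //;
      exact: mg].
  - exact: integrable_add ix i3.
  - by move=> w _; rewrite cE; apply: ascent_step => //; exact: HG.
rewrite RintegralD// RintegralD//; last exact: integrable_scale.
rewrite RintegralD//; last exact: integrable_scale.
rewrite (RintegralD _ (finite_measure_integrable_cst _ _ _))//;
  last exact: integrable_bigsum.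
rewrite cross0 Rintegral_const !RintegralZl// cE.
have := ler_wpM2l (sqr_ge0 eta) vle; lra.
Qed.

End Expectation.
End Ascent.

Lemma telescoped_bound (R : realType) (D S V : R) (K : nat) (a b : nat -> R)
  (eta : R) :
  (0 < K)%N -> 0 < S -> 0 < D -> eta = D / Num.sqrt (K%:R * S) ->
  (forall k, 0 <= a k) -> a 0%N <= D ^+ 2 ->
  (forall k, (k < K)%N -> a k.+1 <= a k + 4 * eta * b k +
    (eta ^+ 2 * S - 2 * eta * V)) ->
  V / 2 - D * Num.sqrt S / (2 * Num.sqrt K%:R) <= K%:R^-1 * \sum_(k < K) b k.
Proof.
move=> K0 S0 D0 etaE a0 aD step.
have kp : 0 < K%:R :> R by rewrite ltr0n.
set s := Num.sqrt S; set r := Num.sqrt K%:R.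
have s0 : 0 < s by rewrite sqrtr_gt0.
have r0 : 0 < r by rewrite sqrtr_gt0.
have rr : r ^+ 2 = K%:R by rewrite sqr_sqrtr// ltW.
have ss : s ^+ 2 = S by rewrite sqr_sqrtr// ltW.
(* The step size balances the two error terms: the initial distance bound [D ^+ 2] equals the
   accumulated [K * eta ^+ 2 * S]. *)
have E : eta * (r * s) = D.
  by rewrite etaE sqrtrM ?ler0n// -/s -/r divfK// gt_eqF// mulr_gt0.
have eta0 : 0 < eta.
  by rewrite etaE divr_gt0// sqrtr_gt0 mulr_gt0.
have tel n : (n <= K)%N -> a n <= a 0%N + 4 * eta * \sum_(k < n) b k +
    n%:R * (eta ^+ 2 * S - 2 * eta * V).
  elim: n => [_|n IH nK]; first by rewrite big_ord0; lra.
  have := IH (ltnW nK); have := step _ nK.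
  rewrite big_ord_recr /= -[n.+1%:R]natr1 mulrDr mulrDl; lra.
have {tel} := tel K (leqnn K); set B := \sum_(k < K) b k => tel.
have := a0 K; rewrite -rr -ss in tel * => aK.
(* Writing both error terms as [D * (eta * (r * s))] exposes a common factor [eta > 0], which is
   then cancelled. *)
have H : 0 <= eta * (2 * D * (r * s) + 4 * B - 2 * r ^+ 2 * V).
  have : r ^+ 2 * (eta ^+ 2 * s ^+ 2) = D * (eta * (r * s)) by rewrite -{1}E;
    ring.
  have : D ^+ 2 = D * (eta * (r * s)) by rewrite E expr2.
  lra.
rewrite pmulr_rge0// in H.
have -> : r ^- 2 * B = B / r ^+ 2 by rewrite mulrC.
rewrite ler_pdivlMr ?exprn_gt0//.
have -> : (V / 2 - D * s / (2 * r)) * r ^+ 2 = V / 2 * r ^+ 2 - D * s * r / 2.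
  by field; rewrite gt_eqF.
lra.
Qed.

(** * The sampled index and the final guarantee *)

Lemma sigma_gen_PME (R : realType) (N : finType) (Act : N -> finType)
    (F : {set ground Act} -> R) (d : measure_display) (T : measurableType d)
    (I : Type) (X : I -> T -> R) (z : T -> {ffun ground Act -> R}) :
  (forall e, exists i, (fun w => z w e) = X i) ->
  forall B : set R, measurable B ->
    sigma_gen X ((fun w => PME F (z w)) @^-1` B)%classic.
Proof.
move=> zX B mB; rewrite -[X in sigma_gen _ X]setTI.
(* [measurable_PME] is applied to the sample space carrying only the generated sigma-algebra. *)
pose T' := g_sigma_algebraType
  (\bigcup_i preimage_set_system setT (X i) measurable)%classic.
apply: (@measurable_PME R N Act F _ T' z) => // e _ C mC.
have [i ->] := zX e; rewrite setTI; exact: sigma_gen_coord.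
Qed.

(** Independence is recast as orthogonality: the centred indicator of [k = j] integrates to zero
    over events of [G], so [null_orthogonal] serves for the index as it does for the noise. *)
Lemma index_null (R : realType) (d : measure_display) (T : measurableType d)
    (P : probability T R) (K : nat) (k : T -> 'I_K) (G : set (set T))
    (f : T -> R) (j : 'I_K) :
  (forall A, G A -> measurable A) -> uniform_index P k -> indep_index P k G ->
  (forall B : set R, measurable B -> G (f @^-1` B)%classic) ->
  null_on_preimages P (fun w => \1_(k @^-1` [set j])%classic w - K%:R^-1) f.
Proof.
move=> Gm ku ki fG B mB; have GA := fG B mB; have mA := Gm _ GA; split=> //.
have [mj Pj] := ku j.
rewrite RintegralB//; last 2 first.
- exact: integrableS (integrable_indic _ mj).
- exact: finite_measure_integrable_cst.
rewrite Rintegral_cst// {1}/Rintegral integral_indic// [X in fine X - _]ki// Pj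
  fineM//.
  by rewrite /= subrr.
exact: fin_num_measure.
Qed.

Theorem theorem5p1 (R : realType)
  (N : finType) (Act : N -> finType) (Act_nonempty : forall i, (0 < #|Act i|)%N)
  (F : {set ground Act} -> R)
  (F_ge0 : forall A, 0 <= F A)
  (F_normalized : set_normalized F)
  (F_monotone : set_monotone F)
  (F_submodular : set_submodular F)
  (F_bounded : bounded_marginals F)
  (D : R) (D_max : is_maximum (distances (@face R N Act)) D)
  (K : nat) (K_ge1 : (1 <= K)%N)
  (G sigma : R) (G_ge0 : 0 <= G) (sigma_ge0 : 0 <= sigma)
  (Gsigma_gt0 : 0 < G ^+ 2 + sigma ^+ 2)
  (eta : R) (eta_def : eta = D / Num.sqrt (K%:R * (G ^+ 2 + sigma ^+ 2)))
  (d : measure_display) (T : measurableType d) (P : probability T R)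
  (x0 : {ffun ground Act -> R}) (x0_face : face x0)
  (g x : nat -> T -> {ffun ground Act -> R})
  (g_random : forall k, (k < K)%N -> random_vector (g k))
  (x_init : forall w, x 0%N w = x0)
  (x_step : forall k w, (k < K)%N ->
     x k.+1 w = euclid_proj (@face R N Act) (x k w + eta *: g k w))
  (grad_le : forall y, face y -> norm2 (grad (PME F) y) <= G)
  (g_unbiased : forall k, (k < K)%N -> forall e : ground Act,
     is_cond_exp P (sigma_vec (x k))
       (fun w => g k w e) (fun w => grad (PME F) (x k w) e))
  (g_variance : forall k, (k < K)%N -> exists V : T -> R,
     is_cond_exp P (sigma_vec (x k))
       (fun w => norm2 (g k w - grad (PME F) (x k w)) ^+ 2) V /\
     {ae P, forall w, V w <= sigma ^+ 2}) :
  ((OPT F / 2 - D * Num.sqrt (G ^+ 2 + sigma ^+ 2) / (2 * Num.sqrt K%:R))%:E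
     <= (K%:R^-1)%:E * \sum_(k < K) 'E_P[fun w => PME F (x k w)])%E
  /\
  (forall kstar : T -> 'I_K,
     uniform_index P kstar ->
     indep_index P kstar
       (sigma_gen (fun (ke : 'I_K * ground Act) (w : T) => x ke.1 w ke.2)) ->
     ((OPT F / 2 - D * (G + sigma) / (2 * Num.sqrt K%:R))%:E
        <= 'E_P[fun w => policy_exp (x (kstar w) w) F])%E).
Proof.
have xF k w : (k <= K)%N -> face (x k w).
  elim: k w => [|k IH] w kK; first by rewrite x_init.
  by rewrite x_step//; have [] := face_nearest (x k w + eta *: g k w) x0_face.
have mx k : (k <= K)%N -> random_vector (x k).
  elim: k => [_ e|k IH kK e]; first by under eq_fun do rewrite x_init;
    exact: measurable_cst.
  under eq_fun do rewrite x_step//.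
  apply: (random_vector_proj x0_face) => e'; under eq_fun do rewrite !ffunE.
  apply: measurable_funD; first exact: IH (ltnW kK) e'.
  by apply: measurable_funM => //; exact: g_random.
have [a aOPT] := OPT_joint_action Act_nonempty F_monotone.
set y := vertex R a; have yF : face y := vertex_face R a.
have gap z : face z -> OPT F - 2 * PME F z <=
    \sum_e grad (PME F) z e * (y e - z e).
  move=> zF; apply: le_trans (grad_vertex _ _ _ Act_nonempty a zF) => //.
  by rewrite lerD2r.
have D_ub z : face z -> norm2 (z - y) <= D.
  by move=> zF; apply: (D_max.2); exists z, y.
have D_ge0 : 0 <= D := le_trans (sqrtr_ge0 _) (D_ub _ yF).
have iPME k : (k <= K)%N ->
  P.-integrable setT (EFin \o (fun w => PME F (x k w))).
  move=> kK; apply: (@bounded_integrable _ _ _ P _ (F [set: ground Act]%SET))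
    => [|w].
    exact: measurable_PME (mx k kK).
  have /andP[? ?] := PME_ge0_le Act_nonempty F_ge0 F_monotone (xF k w kK).
  by rewrite ger0_norm.
pose b k := \int[P]_w PME F (x k w).
have bE k : (k <= K)%N -> 'E_P[fun w => PME F (x k w)]%E = (b k)%:E.
  by move=> kK; rewrite unlock /b /Rintegral fineK//;
    exact: integrable_fin_num (iPME k kK).
have kp : 0 < K%:R :> R by rewrite ltr0n.
have average : OPT F / 2 -
  D * Num.sqrt (G ^+ 2 + sigma ^+ 2) / (2 * Num.sqrt K%:R) <=
    K%:R^-1 * \sum_(k < K) b k.
  (* If [D = 0] the step size vanishes and cannot be cancelled; but the face is then a single point,
     every iterate equals [y], and [gap] directly gives [OPT F <= 2 * PME F y]. *)
  have [D0|D0] := eqVneq D 0.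
    rewrite D0 !mul0r subr0 [leRHS]mulrC ler_pdivlMr// mulr_natr
      -[K in _ *+ K]card_ord -sumr_const.
    apply: ler_sum => k _; rewrite -[leLHS](Rintegral_const P);
      apply: le_Rintegral => //.
    - exact: finite_measure_integrable_cst.
    - exact/iPME/ltnW.
    - move=> w _; have kF := xF k w (ltnW (ltn_ord k)).
      have xy : x k w = y.
        apply/ffunP => e; apply/eqP;
          rewrite -subr_eq0 -sqrf_eq0 eq_le sqr_ge0 andbT.
        have := sqn_le_coord (x k w - y) e; rewrite !ffunE => /le_trans; apply.
        rewrite -norm2_sqr; have := D_ub _ kF; rewrite D0.
        by have := sqrtr_ge0 (\sum_e (x k w - y) e ^+ 2); rewrite -/(norm2 _);
          nra.
      have := gap _ kF; rewrite xy big1; last by move=> e _;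
        rewrite subrr mulr0.
      lra.
  have eta_ge0 : 0 <= eta by rewrite eta_def divr_ge0// sqrtr_ge0.
  apply: (@telescoped_bound _ _ _ _ _ (fun k => \int[P]_w sqn (x k w - y)) b _
    _ _ _ eta_def) => //.
  - by rewrite lt_def D0.
  - by move=> k; apply: Rintegral_ge0 => w _; exact: sqn_ge0.
  - under eq_Rintegral do rewrite x_init.
    rewrite Rintegral_const -norm2_sqr ler_pXn2r ?nnegrE ?sqrtr_ge0//;
      exact: D_ub.
  - move=> k kK; under eq_Rintegral do rewrite x_step//.
    apply: expected_ascent_step => //.
    + by move=> w; exact/xF/ltnW.
    + by move=> w; exact/gap/xF/ltnW.
    + exact/mx/ltnW.
    + exact: g_random.
    + exact: g_unbiased.
    + exact: g_variance.
split.
  under eq_bigr => k _ do rewrite (bE k (ltnW (ltn_ord k))).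
  by rewrite sumEFin -EFinM lee_fin.
move=> kstar ku ki.
have sm A : sigma_gen (fun (ke : 'I_K * ground Act) w => x ke.1 w ke.2) A ->
  measurable A.
  by apply: sigma_gen_measurable => -[k e] /=; exact: (mx _ (ltnW (ltn_ord k))).
pose ind (j : 'I_K) : T -> R := \1_(kstar @^-1` [set j])%classic.
have mind (j : 'I_K) : measurable (kstar @^-1` [set j])%classic by have [] :=
  ku j.
(* Independence of the index factorizes the expectation on the event [kstar = j]. *)
have indF (j : 'I_K) : P.-integrable setT
  (EFin \o (fun w => PME F (x j w) * ind j w)) /\
    \int[P]_w (PME F (x j w) * ind j w) = K%:R^-1 * b j.
  have jK := ltnW (ltn_ord j).
  have bnd w : `|PME F (x j w)| <= F [set: ground Act]%SET.
    have /andP[? ?] := PME_ge0_le Act_nonempty F_ge0 F_monotone (xF j w jK).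
    by rewrite ger0_norm.
  have iind : P.-integrable setT (EFin \o ind j) by exact: integrable_indic.
  have iZ : P.-integrable setT (EFin \o (fun w => ind j w - K%:R^-1)).
    by apply: integrable_sub => //; exact: finite_measure_integrable_cst.
  have i1 := bounded_mul_integrable (measurable_PME F (mx j jK)) bnd iind.
  split=> //.
  have zX e : exists i : 'I_K * ground Act, (fun w => x j w e) =
    (fun w => x i.1 w i.2).
    by exists (j, e).
  have := null_orthogonal iZ (index_null j sm ku ki (sigma_gen_PME F zX)) bnd.
  under eq_Rintegral do rewrite mulrBr.
  rewrite RintegralB//; last first.
    by under [X in EFin \o X]eq_fun do rewrite mulrC; apply: integrable_scale;
      exact: iPME.
  rewrite RintegralZr//; last exact: iPME.
  rewrite -/(b j) => H; rewrite [RHS]mulrC; apply/eqP; rewrite -subr_eq0;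
    apply/eqP; exact: H.
have -> : 'E_P[fun w => policy_exp (x (kstar w) w) F]%E =
  (K%:R^-1 * \sum_(j < K) b j)%:E.
  rewrite unlock.
  (* The random index is eliminated by summing over its possible values; only [j = kstar w]
     contributes at [w]. *)
  have -> : (fun w => (policy_exp (x (kstar w) w) F)%:E) =
      (fun w => (\sum_(j < K) PME F (x j w) * ind j w)%:E).
    apply/funext => w; rewrite -(PME_policy_exp Act_nonempty); last first.
      by case: (xF (kstar w) w (ltnW (ltn_ord _))).
    rewrite (bigD1 (kstar w))//= /ind indicE mem_set// mulr1 big1 ?addr0// =>
      j jk.
    by rewrite indicE memNset ?mulr0// => /= kj; rewrite kj eqxx in jk.
  have isum := integrable_bigsum (index_enum 'I_K) (fun j => (indF j).1).
  rewrite -[LHS]fineK; last exact: integrable_fin_num isum.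
  congr _%:E; rewrite -/(Rintegral P setT _) Rintegral_bigsum;
    last by move=> j; case: (indF j).
  by rewrite mulr_sumr; apply: eq_bigr => j _; case: (indF j).
rewrite lee_fin; apply: le_trans average.
rewrite lerD2l lerN2 ler_pM2r ?invr_gt0 ?mulr_gt0 ?sqrtr_gt0//.
(* The root of [G ^+ 2 + sigma ^+ 2] is at most [G + sigma], since [G * sigma >= 0]. *)
rewrite ler_wpM2l// -[leRHS]ger0_norm ?addr_ge0// -sqrtr_sqr ler_sqrt
  ?sqr_ge0//.
by have := mulr_ge0 G_ge0 sigma_ge0; rewrite sqrrD; lra.
Qed.
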